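(* Let $k\ge3$ be an integer, let $\Phi$ be a linear Monotone NAE-4-SAT instance with $m\ge1$ clauses in which every variable occurs in some clause, and let $G$ be the weighted graph on vertex set $V$ constructed from $\Phi$ and $k$ as described in the context. Then $$\operatorname{SDP}_k(G)=\frac92k(k-1)m$$ and $$\operatorname{SDP}_k(G)-\operatorname{MC}_k(G)=\frac12\min_{\sigma:V\to\{1,\dots,k\}}\ \sum_{j=1}^m\sum_{\ell=1}^k\bigl(L_{j,\ell}(\sigma)-3\bigr)^2 .$$ Moreover, $\operatorname{MC}_k(G)=\operatorname{SDP}_k(G)$ if and only if $\Phi$ is satisfiable.
   Context: A Monotone NAE-4-SAT instance consists of a finite set of Boolean variables and a finite collection of distinct clauses $C_1,\dots,C_m$, each a set of four distinct (unnegated) variables. A clause is satisfied when its four variables are not all assigned the same value; $\Phi$ is satisfiable if some assignment satisfies all clauses. It is linear if any two distinct clauses share at most one variable. Construction: for each clause $C_j$ introduce two private auxiliary vertices $d_{j,1},d_{j,2}$ and set $B_j=C_j\cup\{d_{j,1},d_{j,2}\}$. Let $V$ consist of all variables, all auxiliary vertices, and $k-2$ additional anchor vertices $a_1,\dots,a_{k-2}$ shared by all clauses. For each $j$ define $b_j\in\mathbb Z^V$ by $(b_j)_v=1$ if $v\in B_j$, $(b_j)_v=3$ if $v\in\{a_1,\dots,a_{k-2}\}$, and $(b_j)_v=0$ otherwise. Let $M=\sum_{j=1}^mb_jb_j^\top$ and let $G$ be the graph on $V$ with edge weights $W_{uv}=M_{uv}$ for $u\ne v$ and $W_{uu}=0$.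 For $\sigma:V\to\{1,\dots,k\}$ set $L_{j,\ell}(\sigma)=\sum_{v\in V,\ \sigma(v)=\ell}(b_j)_v$. $\operatorname{MC}_k(G)$ is the maximum total weight of edges joining different parts over partitions of $V$ into at most $k$ parts. The Frieze--Jerrum relaxation is $$\operatorname{SDP}_k(G)=\max_X\ \frac{k-1}{k}\sum_{u<v}W_{uv}(1-X_{uv})$$ over real symmetric matrices $X$ indexed by $V$ with $X\succeq0$, $X_{uu}=1$ for all $u$, and $X_{uv}\ge-\frac1{k-1}$ for all $u\ne v$ (sum over unordered pairs of distinct vertices). *)

(* Defs.v *)
From HB Require Import structures.
From mathcomp Require Import all_boot all_order all_algebra.
From mathcomp Require Import classical_sets reals.

Set Implicit Arguments.
Unset Strict Implicit.
Unset Printing Implicit Defensive.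

Import Order.TTheory GRing.Theory Num.Theory.
Local Open Scope ring_scope.
Local Open Scope classical_set_scope.

Definition is_max (R : realType) (A : set R) (x : R) : Prop :=
  A x /\ ubound A x.

Definition is_min (R : realType) (A : set R) (x : R) : Prop :=
  A x /\ lbound A x.

(* An instance on the variable set X with clauses C_1, ..., C_m is the family
   C : 'I_m -> {set X}; the clauses being distinct is injectivity of C. *)
Definition monotone_nae4sat (X : finType) (m : nat) (C : 'I_m -> {set X}) :
    Prop :=
  injective C /\ forall j, #|C j| = 4%N.

Definition linear_instance (X : finType) (m : nat) (C : 'I_m -> {set X}) :
    Prop :=
  forall i j, i != j -> (#|C i :&: C j| <= 1)%N.

Definition nae_satisfies (X : finType) (t : X -> bool) (c : {set X}) : Prop :=
  ~ exists b : bool, forall x, x \in c -> t x = b.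

Definition nae_satisfiable (X : finType) (m : nat) (C : 'I_m -> {set X}) :
    Prop :=
  exists t : X -> bool, forall j, nae_satisfies t (C j).

(* Variables, then the auxiliary vertices d_(j,1) and d_(j,2), then the k - 2
   anchors. The subtraction is truncated, so this is meant for 2 <= k. *)
Definition vertex (X : finType) (m k : nat) : finType :=
  (X + 'I_m * 'I_2 + 'I_(k - 2))%type.

Definition bvec (X : finType) (m k : nat) (C : 'I_m -> {set X}) (j : 'I_m)
    (v : vertex X m k) : int :=
  match v with
  | inl (inl x) => if x \in C j then 1 else 0
  | inl (inr (i, _)) => if i == j then 1 else 0
  | inr _ => 3
  end.

Definition gram (X : finType) (m k : nat) (C : 'I_m -> {set X})
    (u v : vertex X m k) : int :=
  \sum_(j < m) bvec C j u * bvec C j v.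

Definition graph_weight (R : realType) (X : finType) (m k : nat)
    (C : 'I_m -> {set X}) (u v : vertex X m k) : R :=
  if u == v then 0 else (gram C u v)%:~R.

Definition colour_load (X : finType) (m k : nat) (C : 'I_m -> {set X})
    (s : vertex X m k -> 'I_k) (j : 'I_m) (l : 'I_k) : int :=
  \sum_(v | s v == l) bvec C j v.

Definition load_defect (R : realType) (X : finType) (m k : nat)
    (C : 'I_m -> {set X}) (s : vertex X m k -> 'I_k) : R :=
  (\sum_(j < m) \sum_(l < k) (colour_load C s j l - 3) ^+ 2)%:~R.

(* Sum over unordered pairs of distinct vertices, each pair listed once
   according to the enumeration order of V. *)
Definition pair_sum (R : realType) (V : finType) (F : V -> V -> R) : R :=
  \sum_u \sum_(v | (enum_rank u < enum_rank v)%N) F u v.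

Definition cut_weight (R : realType) (V : finType) (W : V -> V -> R)
    (P : {set {set V}}) : R :=
  pair_sum (fun u v : V =>
    if finset.pblock P u != finset.pblock P v then W u v else 0).

Definition is_MC (R : realType) (V : finType) (k : nat) (W : V -> V -> R)
    (x : R) : Prop :=
  is_max [set y | exists P : {set {set V}},
    [/\ finset.partition P [set: V]%SET, (#|P| <= k)%N & y = cut_weight W P]] x.

(* Real matrices indexed by V are functions V -> V -> R. *)
Definition psd (R : realType) (V : finType) (X : V -> V -> R) : Prop :=
  (forall u v, X u v = X v u) /\
  (forall x : V -> R, 0 <= \sum_u \sum_v x u * X u v * x v).

Definition FJ_feasible (R : realType) (V : finType) (k : nat)
    (X : V -> V -> R) : Prop :=
  [/\ psd X, forall u, X u u = 1 &
      forall u v, u != v -> - (k%:R - 1)^-1 <= X u v].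

Definition FJ_objective (R : realType) (V : finType) (k : nat)
    (W X : V -> V -> R) : R :=
  (k%:R - 1) / k%:R * pair_sum (fun u v => W u v * (1 - X u v)).

Definition is_SDP (R : realType) (V : finType) (k : nat) (W : V -> V -> R)
    (x : R) : Prop :=
  is_max [set y | exists X : V -> V -> R,
    FJ_feasible k X /\ y = FJ_objective k W X] x.

(* Main.v *)
Require Import Defs.
From mathcomp Require Import all_boot all_order all_algebra.
From mathcomp Require Import classical_sets reals.
From mathcomp Require Import ring lra zify.

Set Implicit Arguments.
Unset Strict Implicit.
Unset Printing Implicit Defensive.

Import Order.TTheory GRing.Theory Num.Theory.
Local Open Scope ring_scope.
Local Open Scope classical_set_scope.

(** Write [b_j] for the clause vectors.  They have coordinate sum [3k], and the
    weights of the graph are the off-diagonal entries of [sum_j b_j b_j^T], so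
    for every symmetric matrix [A] with unit diagonal
      [sum_(u<v) W_uv (1 - A_uv) = 1/2 sum_j ((3k)^2 - b_j^T A b_j)]
    ([weighted_pair_sum]).  This identity is used twice.

    For a feasible matrix the terms [b_j^T A b_j] are nonnegative, which gives
    [SDP <= 9/2 k(k-1)m]; equality needs a feasible matrix annihilated by every
    [b_j].  To find one, take the [k] vertices [e_1, ..., e_k] of a regular
    simplex, and give the vector [e_a] to the anchor [a].  All other vertices
    get vectors [(e_(k-1) + e_k)/2 + y_v], with [y_v] orthogonal to the simplex and as long
    as [(e_(k-1) - e_k)/2].  The entry bound between two such vertices is then
    just the Cauchy-Schwarz inequality for the [y_v], and [b_j] is annihilated
    as soon as the six [y_v] of the clause block sum to zero.  With an
    orthogonal family [y_x] on the variables, the four variables of a clause sum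
    to a vector of twice the common length, so both auxiliary vertices can be
    given minus one half of that sum.  The definition [witness] is the
    Gram matrix of this configuration.

    A colouring [s] corresponds to the matrix [A_uv = [s u = s v]], for which
    [b_j^T A b_j] is the sum of the squared loads.  Since the loads of a clause
    sum to [3k], this sum is [9k] plus the defect of the clause, and the cut is
    [9/2 k(k-1)m] minus half the total defect ([colouring_cut]).

    Finally the defect can be zero exactly when all loads can be made equal to
    [3].  Then each anchor, of weight [3], has a colour of its own and fills
    it, so the six vertices of each clause block split three and three between
    the two remaining colours, and the four variables of the clause cannot
    agree.  Conversely a clause whose variables split [n] to [4 - n] with
    [1 <= n <= 3] is balanced by its two auxiliary vertices. *)

(** * The pair sum as a quadratic form *)

Definition quad_form (R : realType) (V : finType) (A : V -> V -> R)
    (x : V -> R) : R :=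
  \sum_u \sum_v x u * A u v * x v.

Lemma pair_sum_half (R : realType) (V : finType) (F : V -> V -> R) :
  (forall u v, F u v = F v u) -> (forall u, F u u = 0) ->
  pair_sum F = 1 / 2 * \sum_u \sum_v F u v.
Proof.
move=> Fsym F0.
have swap : pair_sum F = \sum_u \sum_(v | (enum_rank v < enum_rank u)%N) F u v.
  rewrite /pair_sum (exchange_big_dep xpredT) //=.
  by apply: eq_bigr => u _; apply: eq_bigr.
suff -> : \sum_u \sum_v F u v = pair_sum F + pair_sum F by field.
rewrite {2}swap /pair_sum -big_split /=; apply: eq_bigr => u _.
rewrite (bigID (fun v => (enum_rank u < enum_rank v)%N)) /=; congr (_ + _).
rewrite (bigD1 u) /= ?ltnn // F0 add0r; apply: eq_bigl => v.
rewrite -leqNgt ltn_neqAle andbC; congr (_ && _).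
by rewrite -(inj_eq enum_rank_inj) -val_eqE.
Qed.

(** Every evaluation on a clause vector below (total, loads, coordinates of the
    witness) is an instance of this formula. *)
Lemma clause_sum (R : pzRingType) (X : finType) (m k : nat)
    (C : 'I_m -> {set X}) (j : 'I_m) (f : vertex X m k -> R) :
  \sum_v (bvec C j v)%:~R * f v =
  \sum_(x in C j) f (inl (inl x)) + \sum_(h < 2) f (inl (inr (j, h)))
  + 3 * \sum_(a < k - 2) f (inr a).
Proof.
rewrite big_sumType /= big_sumType /=; congr (_ + _ + _).
- rewrite [RHS]big_mkcond; apply: eq_bigr => x _ /=.
  by case: (x \in C j); rewrite ?mul1r ?mul0r.
- transitivity (\sum_(i < m) \sum_(h < 2)
    (if i == j then 1 else 0 : int)%:~R * f (inl (inr (i, h)))).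
    by rewrite pair_big; apply: eq_bigr => -[i h].
  rewrite (bigD1 j) //= [X in _ + X]big1 ?addr0 => [|i /negPf ->].
    by apply: eq_bigr => h _; rewrite eqxx mul1r.
  by rewrite big1 // => h _; rewrite mul0r.
- by rewrite big_distrr.
Qed.

Lemma clause_total (R : realType) (X : finType) (m k : nat)
    (C : 'I_m -> {set X}) (j : 'I_m) :
  (2 <= k)%N -> #|C j| = 4%N ->
  \sum_(v : vertex X m k) (bvec C j v)%:~R = 3 * k%:R :> R.
Proof.
move=> k2 C4.
under eq_bigr => v _ do rewrite -[_%:~R]mulr1.
rewrite clause_sum !sumr_const C4 !card_ord natrB //; ring.
Qed.

(** Since [A] has unit diagonal, [1 - A] vanishes on the diagonal, so the
    diagonal of the Gram matrix of the clause vectors may be kept in the sum;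
    what remains is [1/2 sum_j b_j^T (J - A) b_j] with [J] the all-ones
    matrix. *)
Lemma weighted_pair_sum (R : realType) (X : finType) (m k : nat)
    (C : 'I_m -> {set X}) (A : vertex X m k -> vertex X m k -> R) :
  (2 <= k)%N -> (forall j, #|C j| = 4%N) ->
  (forall u v, A u v = A v u) -> (forall u, A u u = 1) ->
  pair_sum (fun u v => graph_weight R C u v * (1 - A u v)) =
  1 / 2 * \sum_j ((3 * k%:R) ^+ 2
                  - quad_form A (fun v => (bvec C j v)%:~R)).
Proof.
move=> k2 C4 Asym A1; rewrite pair_sum_half; last 2 first.
- move=> u v; rewrite Asym /graph_weight eq_sym /gram.
  by under eq_bigr => j _ do rewrite mulrC.
- by move=> u; rewrite /graph_weight eqxx mul0r.
congr (_ * _).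
transitivity (\sum_u \sum_v \sum_j
   ((bvec C j u)%:~R * (bvec C j v)%:~R * (1 - A u v))).
  apply: eq_bigr => u _; apply: eq_bigr => v _; rewrite -mulr_suml.
  rewrite /graph_weight; case: eqP => [->|_].
    by rewrite A1 subrr !mulr0.
  rewrite /gram rmorph_sum; congr (_ * _).
  by apply: eq_bigr => j _; rewrite rmorphM.
under eq_bigr => u _ do rewrite exchange_big.
rewrite exchange_big; apply: eq_bigr => j _ /=.
rewrite -(clause_total R k2 (C4 j)) expr2 big_distrl /quad_form /= -sumrB.
apply: eq_bigr => u _; rewrite big_distrr -sumrB; apply: eq_bigr => v _ /=.
ring.
Qed.

Lemma quad_form_sum_squares (R : realType) (V I : finType) (c : I -> R)
    (z : I -> V -> R) (x : V -> R) :
  quad_form (fun u v => \sum_i c i * z i u * z i v) x =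
  \sum_i c i * (\sum_v x v * z i v) ^+ 2.
Proof.
rewrite /quad_form.
transitivity (\sum_u \sum_v \sum_i c i * ((x u * z i u) * (x v * z i v))).
  apply: eq_bigr => u _; apply: eq_bigr => v _.
  rewrite big_distrr big_distrl; apply: eq_bigr => i _ /=; ring.
under eq_bigr => u _ do rewrite exchange_big.
rewrite exchange_big; apply: eq_bigr => i _ /=.
rewrite expr2 big_distrl big_distrr; apply: eq_bigr => u _ /=.
by rewrite !big_distrr.
Qed.

(** * A feasible matrix annihilated by all clause vectors *)

Section Witness.
Variables (R : realType) (X : finType) (m k : nat) (C : 'I_m -> {set X}).
Local Notation V := (vertex X m k).

(** The components [y_v], rescaled to unit length: an orthonormal basis on the
    variables, and minus half the sum of the basis vectors of a clause on both
    of its auxiliary vertices. *)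
Definition spread (x : X) (v : V) : R :=
  match v with
  | inl (inl y) => (x == y)%:R
  | inl (inr (j, _)) => - (1 / 2) * (x \in C j)%:R
  | inr _ => 0
  end.

Definition non_anchor (v : V) : R := if v is inl _ then 1 else 0.

Definition anchor (a : 'I_(k - 2)) (v : V) : R :=
  if v is inr b then (a == b)%:R else 0.

(** Up to scaling, the simplex vertices are the vectors of an orthonormal basis
    of [R^k] minus their mean.  Merging the last two basis coordinates, which
    agree in the simplex part of all the vectors, into their sum
    leaves one coordinate per anchor, with mean [1/k], and one with mean [2/k];
    the merged coordinate has to be weighted by [1/2] in [coord_scale], which also gives the
    components [y_v] their length.  The factor [k/(k-1)] normalizes the simplex
    vertices. *)
Definition centred_coord (i : 'I_(k - 2) + unit + X) (v : V) : R :=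
  match i with
  | inl (inl a) => anchor a v - k%:R^-1
  | inl (inr _) => non_anchor v - 2 / k%:R
  | inr x => spread x v
  end.

Definition coord_scale (i : 'I_(k - 2) + unit + X) : R :=
  k%:R / (k%:R - 1) * (if i is inl (inl _) then 1 else 1 / 2).

Definition witness (u v : V) : R :=
  \sum_i coord_scale i * centred_coord i u * centred_coord i v.

Hypothesis k2 : (2 <= k)%N.
Hypothesis C4 : forall j, #|C j| = 4%N.

Let k_gt1 : 1 < k%:R :> R.
Proof. by rewrite ltr1n. Qed.

Lemma sum_anchor (v : V) : \sum_a anchor a v = 1 - non_anchor v.
Proof.
case: v => [v|b] /=; first by rewrite big1 // subrr.
by rewrite (bigD1 b) //= eqxx big1 ?addr0 ?subr0 // => a /negPf ->.
Qed.

(** Centring subtracts exactly [1/k] from each uncentred inner product, because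
    the uncentred vectors all have the same inner product [1] with the vector
    of squared norm [k] that is projected out; after scaling this is the bound
    [1/(k-1)]. *)
Lemma witnessE (u v : V) :
  witness u v = k%:R / (k%:R - 1) *
    (\sum_a anchor a u * anchor a v
     + 1 / 2 * (non_anchor u * non_anchor v + \sum_x spread x u * spread x v))
    - (k%:R - 1)^-1.
Proof.
rewrite /witness big_sumType /= big_sumType /=.
rewrite (big_pred1 tt) => [|[]] //=.
have -> : \sum_a coord_scale (inl (inl a)) * centred_coord (inl (inl a)) u *
    centred_coord (inl (inl a)) v = k%:R / (k%:R - 1) *
  (\sum_a anchor a u * anchor a v
   - k%:R^-1 * \sum_a anchor a u - k%:R^-1 * \sum_a anchor a v
   + \sum_(a < k - 2) k%:R^-1 * k%:R^-1).
  rewrite !big_distrr -!sumrB -big_split big_distrr /=.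
  by apply: eq_bigr => a _; rewrite /coord_scale /=; ring.
have -> : \sum_x coord_scale (inr x) * spread x u * spread x v =
    k%:R / (k%:R - 1) * (1 / 2 * \sum_x spread x u * spread x v).
  by rewrite !big_distrr; apply: eq_bigr => x _; rewrite /coord_scale /=; ring.
rewrite !sum_anchor sumr_const card_ord -[_ *+ (k - 2)]mulr_natl natrB //.
rewrite /coord_scale /=; field.
by have := k_gt1; lra.
Qed.

Lemma spread_norm (v : V) : \sum_x spread x v ^+ 2 = non_anchor v.
Proof.
case: v => [[y|[j h]]|a] /=.
- rewrite (bigD1 y) //= eqxx big1 ?addr0 ?expr1n // => x /negPf ->.
  by rewrite expr0n.
- transitivity (\sum_(x in C j) (1 / 4 : R)).
    rewrite [RHS]big_mkcond; apply: eq_bigr => x _.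
    by case: (x \in C j); rewrite /=; field.
  by rewrite sumr_const C4; field.
- by rewrite big1 // => x _; rewrite expr0n.
Qed.

(** Cauchy-Schwarz for the unit vectors [y_u] and [y_v], from the expansion of
    the squared norm of [y_u + y_v]. *)
Lemma spread_dot_ge (u v : V) :
  0 <= non_anchor u * non_anchor v + \sum_x spread x u * spread x v.
Proof.
have [[a ->]|Nu] : (exists a, u = inr a) \/ non_anchor u = 1.
  by case: u => [u|a]; [right | left; exists a].
  by rewrite mul0r add0r sumr_ge0 // => x _; rewrite mul0r.
have [[a ->]|Nv] : (exists a, v = inr a) \/ non_anchor v = 1.
  by case: v => [v|a]; [right | left; exists a].
  by rewrite mulr0 add0r sumr_ge0 // => x _; rewrite mulr0.
have : 0 <= \sum_x (spread x u + spread x v) ^+ 2.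
  by apply: sumr_ge0 => x _; apply: sqr_ge0.
under eq_bigr => x _ do rewrite sqrrD -mulr_natl.
by rewrite !big_split /= -big_distrr /= !spread_norm Nu Nv; lra.
Qed.

Lemma witness_feasible : FJ_feasible k witness.
Proof.
have k1 := k_gt1.
have c0 : 0 <= k%:R / (k%:R - 1) :> R by apply: divr_ge0; lra.
split.
- split=> [u v|x]; first by apply: eq_bigr => i _; rewrite mulrAC.
  rewrite -[leRHS]/(quad_form witness x) quad_form_sum_squares.
  apply: sumr_ge0 => i _; apply: mulr_ge0; last exact: sqr_ge0.
  by apply: mulr_ge0 => //; case: i => [[a|i]|i]; lra.
- move=> u; rewrite witnessE.
  have -> : \sum_a anchor a u * anchor a u = \sum_a anchor a u.
    apply: eq_bigr => a _; case: u => [u|b] /=; first by rewrite mul0r.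
    by case: (a == b); rewrite ?mul1r ?mul0r.
  have -> : \sum_x spread x u * spread x u = non_anchor u.
    by rewrite -spread_norm; apply: eq_bigr => x _; rewrite expr2.
  rewrite sum_anchor.
  have -> : non_anchor u * non_anchor u = non_anchor u.
    by case: u => u /=; rewrite ?mul1r ?mul0r.
  by field; lra.
- move=> u v _; rewrite witnessE -[leLHS]add0r lerD2r mulr_ge0 // addr_ge0 //.
    apply: sumr_ge0 => a _; apply: mulr_ge0.
      by case: u => //= b; apply: ler0n.
    by case: v => //= b; apply: ler0n.
  by apply: mulr_ge0; [lra | apply: spread_dot_ge].
Qed.

(** The block of a clause has weighted centre zero in each coordinate: an anchor
    has weight [3], a share [1/k] of the total; the six other vertices make up
    the share [2/k]; and the [y_v] cancel by the choice of the auxiliary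
    vectors. *)
Lemma witness_balanced (j : 'I_m) :
  quad_form witness (fun v => (bvec C j v)%:~R) = 0.
Proof.
have k0 : k%:R != 0 :> R by rewrite pnatr_eq0; case: (k) k2.
rewrite quad_form_sum_squares big1 // => i _; apply/eqP.
rewrite mulf_eq0 expf_eq0 /=; apply/orP; right; apply/eqP.
rewrite clause_sum.
case: i => [[a|_]|x] /=.
- rewrite !sumr_const C4 card_ord sumrB sumr_const card_ord.
  rewrite (bigD1 a) //= eqxx big1 => [|b]; last by rewrite eq_sym => /negPf ->.
  by rewrite -[_ *+ (k - 2)]mulr_natl natrB //=; field.
- rewrite !sumr_const C4 !card_ord -[_ *+ (k - 2)]mulr_natl natrB //.
  by field.
- rewrite [\sum_(_ < k - 2) _]big1 // sumr_const card_ord.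
  suff -> : \sum_(y in C j) (x == y)%:R = (x \in C j)%:R :> R by field.
  have [xC|xC] := boolP (x \in C j).
    by rewrite (bigD1 x) //= eqxx big1 ?addr0 // => y /andP[_];
      rewrite eq_sym => /negPf ->.
  rewrite big1 // => y yC; case: eqP => // xy.
  by rewrite xy yC in xC.
Qed.

End Witness.

(** * Colourings and cuts *)

Definition same_colour (R : realType) (V T : finType) (s : V -> T)
    (u v : V) : R :=
  (s u == s v)%:R.

Lemma quad_form_same_colour (R : realType) (V T : finType) (s : V -> T)
    (x : V -> R) :
  quad_form (same_colour R s) x = \sum_l (\sum_(v | s v == l) x v) ^+ 2.
Proof.
rewrite /quad_form (partition_big s xpredT) //=; apply: eq_bigr => l _.
rewrite expr2 big_distrl /=; apply: eq_bigr => u /eqP su.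
rewrite big_distrr [RHS]big_mkcond /=; apply: eq_bigr => v _.
rewrite /same_colour su eq_sym.
by case: (s v == l); rewrite ?mulr1 // mulr0 mul0r.
Qed.

Lemma partition_colouring (V : finType) (k : nat) (P : {set {set V}}) :
  finset.partition P [set: V]%SET -> (#|P| <= k)%N ->
  exists s : V -> 'I_k,
    forall u v, (finset.pblock P u == finset.pblock P v) = (s u == s v).
Proof.
move=> /and3P[/eqP cP _ _] Pk.
have inP v : finset.pblock P v \in enum P.
  by rewrite mem_enum pblock_mem ?cP ?inE.
have ltk v : (index (finset.pblock P v) (enum P) < k)%N.
  by apply: leq_trans Pk; rewrite cardE index_mem.
exists (fun v => Ordinal (ltk v)) => u v; rewrite -[RHS]val_eqE /=.
apply/eqP/eqP => [-> // | e].
by rewrite -(nth_index finset.set0 (inP u)) e nth_index.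
Qed.

Lemma colouring_partition (V : finType) (k : nat) (s : V -> 'I_k) :
  exists P : {set {set V}},
  [/\ finset.partition P [set: V]%SET, (#|P| <= k)%N &
    forall u v, (finset.pblock P u == finset.pblock P v) = (s u == s v)].
Proof.
have Ppart := preim_partitionP s [set: V]%SET.
exists (preim_partition s [set: V]%SET); split=> //.
- pose B (l : 'I_k) := [set v | s v == l]%SET.
  apply: leq_trans (_ : #|[set B l | l in 'I_k]%SET| <= k)%N; last first.
    by rewrite -[leqRHS]card_ord leq_imset_card.
  apply/subset_leq_card; apply/fintype.subsetP => A /imsetP[u _ ->].
  apply/imsetP; exists (s u) => //; apply/setP => v.
  by rewrite !inE eq_sym.
- move=> u v; have /and3P[/eqP cP tP _] := Ppart.
  rewrite eq_pblock ?cP ?inE //.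
  by rewrite pblock_equivalence_partition ?inE // => x y z _ _ _; split=> // /eqP ->.
Qed.

Lemma card_indicator (T : finType) (A : {set T}) (P : pred T) :
  \sum_(x in A) (P x)%:R = Posz #|[set x in A | P x]%SET|.
Proof.
rewrite -sum1dep_card -natz natr_sum [RHS]big_mkcondr /=.
by apply: eq_bigr => x _; case: (P x).
Qed.

Section Colourings.
Variables (R : realType) (X : finType) (m k : nat) (C : 'I_m -> {set X}).
Local Notation V := (vertex X m k).
Hypothesis k2 : (2 <= k)%N.
Hypothesis C4 : forall j, #|C j| = 4%N.

(** [sum_l (L_l - 3)^2 = sum_l L_l^2 - 6 * 3k + 9k], since the loads of a clause
    sum to [3k]. *)
Lemma load_defectE (s : V -> 'I_k) :
  load_defect R C s =
  \sum_j (quad_form (same_colour R s) (fun v => (bvec C j v)%:~R) - 9 * k%:R).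
Proof.
rewrite /load_defect rmorph_sum; apply: eq_bigr => j _.
rewrite quad_form_same_colour rmorph_sum /=.
pose L l : R := \sum_(v | s v == l) (bvec C j v)%:~R.
have LE l : (colour_load C s j l)%:~R = L l by rewrite rmorph_sum.
transitivity (\sum_l (L l ^+ 2 - 6 * L l + 9)).
  by apply: eq_bigr => l _; rewrite rmorphXn rmorphB /= LE; ring.
rewrite big_split sumrB -big_distrr /= sumr_const card_ord.
have -> : \sum_l L l = 3 * k%:R.
  by rewrite -(clause_total R k2 (C4 j)) [RHS](partition_big s xpredT).
by rewrite -[_ *+ k]mulr_natl /L; ring.
Qed.

Lemma colouring_cut (s : V -> 'I_k) :
  pair_sum (fun u v => if s u != s v then graph_weight R C u v else 0) =
  9 / 2 * k%:R * (k%:R - 1) * m%:R - 1 / 2 * load_defect R C s.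
Proof.
transitivity (pair_sum (fun u v =>
    graph_weight R C u v * (1 - same_colour R s u v))).
  apply: eq_bigr => u _; apply: eq_bigr => v _; rewrite /same_colour.
  by case: eqP; rewrite ?subrr ?mulr0 // subr0 mulr1.
rewrite weighted_pair_sum //.
- rewrite load_defectE !sumrB !sumr_const card_ord.
  by rewrite -[(_ ^+ 2) *+ m]mulr_natl -[_ * k%:R *+ m]mulr_natl; field.
- by move=> u v; rewrite /same_colour eq_sym.
- by move=> u; rewrite /same_colour eqxx.
Qed.

Lemma colour_loadE (s : V -> 'I_k) (j : 'I_m) (l : 'I_k) :
  colour_load C s j l =
  (#|[set x in C j | s (inl (inl x)) == l]%SET|
   + #|[set h | s (inl (inr (j, h))) == l]%SET|
   + 3 * #|[set a | s (inr a) == l]%SET|)%N.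
Proof.
rewrite /colour_load big_mkcond /=.
transitivity (\sum_v (bvec C j v)%:~R * (s v == l)%:R : int).
  by apply: eq_bigr => v _; rewrite intz; case: eqP; rewrite ?mulr1 ?mulr0.
have setT_sum (T : finType) (P : pred T) :
    \sum_x (P x)%:R = Posz #|[set x | P x]%SET|.
  rewrite -[in RHS](finset.setTI [set x | P x]%SET) -finset.setIdE -card_indicator.
  by apply: eq_bigl => x; rewrite inE.
by rewrite clause_sum card_indicator !setT_sum.
Qed.

(** * Balanced colourings and satisfiability *)

Lemma load_defect_ge0 (s : V -> 'I_k) : 0 <= load_defect R C s.
Proof.
rewrite /load_defect ler0z; apply: sumr_ge0 => j _; apply: sumr_ge0 => l _.
exact: sqr_ge0.
Qed.

Lemma load_defect_eq0 (s : V -> 'I_k) :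
  load_defect R C s = 0 <-> forall j l, colour_load C s j l = 3.
Proof.
split=> [/eqP|bal]; last first.
  rewrite /load_defect big1 // => j _; rewrite big1 // => l _.
  by rewrite bal subrr expr0n.
rewrite /load_defect intr_eq0 psumr_eq0 => [/allP e j l|j _]; last first.
  by apply: sumr_ge0 => l _; apply: sqr_ge0.
have := e j (mem_index_enum j); rewrite psumr_eq0 => [/allP ej|l' _]; last first.
  exact: sqr_ge0.
by have := ej l (mem_index_enum l); rewrite /= sqrf_eq0 subr_eq0 => /eqP.
Qed.

(** Anchors get distinct colours and each variable one of the two remaining
    colours, according to its value.  If [n] variables of a clause are true,
    then [1 <= n <= 3] and [3 - n] of its auxiliary vertices must be coloured
    as true. *)
Lemma balanced_of_satisfiable :
  nae_satisfiable C -> exists s : V -> 'I_k, forall j l, colour_load C s j l = 3.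
Proof.
move=> [t sat].
pose n j := #|[set x in C j | t x]%SET|.
pose n' j := #|[set x in C j | ~~ t x]%SET|.
have nn' j : (n j + n' j = 4)%N.
  rewrite -(C4 j) -(cardsID [set x | t x]%SET (C j)) /n /n'.
  by congr (_ + _)%N; apply: eq_card => x; rewrite !inE // andbC.
have n_gt0 j : (0 < n j)%N.
  rewrite lt0n; apply/negP => /eqP/cards0_eq e; apply: (sat j).
  exists false => x xC; apply/negbTE/negP => tx.
  by move/setP/(_ x): e; rewrite !inE xC tx.
have n'_gt0 j : (0 < n' j)%N.
  rewrite lt0n; apply/negP => /eqP/cards0_eq e; apply: (sat j).
  exists true => x xC; apply/negPn/negP => tx.
  by move/setP/(_ x): e; rewrite !inE xC tx.
have col_lt (b : bool) : ((if b then k - 1 else k - 2) < k)%N.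
  by case: b; lia.
pose col b := Ordinal (col_lt b).
have col_inj : injective col by move=> [] [] // /(congr1 val) /=; lia.
pose anc (a : 'I_(k - 2)) : 'I_k := widen_ord (leq_subr 2 k) a.
have anc_inj : injective anc by move=> a b /(congr1 val) /= /val_inj.
have anc_col a b : (anc a == col b) = false.
  by rewrite -val_eqE /=; have := ltn_ord a; case: b; lia.
(* The auxiliary vertex 0 is true when n <= 2 and the vertex 1 when n <= 1. *)
pose s (v : V) : 'I_k := match v with
  | inl (inl x) => col (t x)
  | inl (inr (j, h)) => col (n j + h <= 2)%N
  | inr a => anc a
  end.
exists s => j l; rewrite colour_loadE.
have [[a ->]|[b ->]] : (exists a, l = anc a) \/ (exists b, l = col b).
  have := ltn_ord l; have [lt|ge] := ltnP l (k - 2).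
    by left; exists (Ordinal lt); apply: val_inj.
  by right; exists (val l == k - 1)%N; apply: val_inj => /=; case: eqP; lia.
- have -> : [set x in C j | s (inl (inl x)) == anc a]%SET = finset.set0.
    by apply/setP => x; rewrite !inE /= eq_sym anc_col andbF.
  have -> : [set h | s (inl (inr (j, h))) == anc a]%SET = finset.set0.
    by apply/setP => h; rewrite !inE /= eq_sym anc_col.
  have -> : [set a' | s (inr a') == anc a]%SET = [set a]%SET.
    by apply/setP => a'; rewrite !inE /= (inj_eq anc_inj).
  by rewrite !cards0 cards1.
- have -> : [set a | s (inr a) == col b]%SET = finset.set0.
    by apply/setP => a; rewrite !inE /= anc_col.
  rewrite cards0 -(sum1dep_card (fun h => s (inl (inr (j, h))) == col b)).
  rewrite big_mkcond !big_ord_recl big_ord0 /= !(inj_eq col_inj).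
  have -> : #|[set x in C j | col (t x) == col b]%SET| = if b then n j else n' j.
    rewrite /n /n'; case: b; apply: eq_card => x;
    by rewrite !inE (inj_eq col_inj); case: (t x).
  move: (nn' j) (n_gt0 j) (n'_gt0 j); rewrite /bump /=.
  by case: b; case: (n j) => [|[|[|[|p]]]] //=; lia.
Qed.

(** Two anchors of one colour would give a load of at least [6], so exactly two
    colours miss the anchors.  A variable in the colour of an anchor would give
    a load of at least [4] there, so all variables of clauses have these two
    colours, and a clause of a single colour would again have load [4]. *)
Lemma satisfiable_of_balanced (s : V -> 'I_k) :
  (1 <= m)%N -> (forall j l, colour_load C s j l = 3) -> nae_satisfiable C.
Proof.
move=> m1 bal.
have {}bal j l : (#|[set x in C j | s (inl (inl x)) == l]%SET|
   + #|[set h | s (inl (inr (j, h))) == l]%SET|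
   + 3 * #|[set a | s (inr a) == l]%SET| = 3)%N.
  by have := bal j l; rewrite colour_loadE => -[].
have anc_inj : injective (fun a => s (inr a)).
  move=> a b e; have := bal (Ordinal m1) (s (inr b)) => load.
  have /card_le1_eqP : (#|[set a | s (inr a) == s (inr b)]%SET| <= 1)%N by lia.
  by apply; rewrite inE // e.
have card_rest : #|~: [set s (inr a) | a in 'I_(k - 2)]%SET| == 2.
  by rewrite cardsCs finset.setCK card_imset // !card_ord subKn.
have /cards2P[c [c' [_ rest]]] := card_rest.
exists (fun x => s (inl (inl x)) == c) => j [b tb].
have [l all_l] : exists l, forall x, x \in C j -> s (inl (inl x)) = l.
  case: b tb => tb; first by exists c => x /tb /eqP.
  exists c' => x xC; apply/eqP; have := tb x xC.
  suff : s (inl (inl x)) \in [set c; c']%SET by rewrite !inE => /orP[->|].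
  rewrite -rest inE; apply/negP => /imsetP[a _ e].
  have := bal j (s (inr a)).
  have : (0 < #|[set y in C j | s (inl (inl y)) == s (inr a)]%SET|)%N.
    by apply/card_gt0P; exists x; rewrite !inE xC e eqxx.
  have : (0 < #|[set b | s (inr b) == s (inr a)]%SET|)%N.
    by apply/card_gt0P; exists a; rewrite inE.
  by lia.
have := bal j l.
have -> : [set x in C j | s (inl (inl x)) == l]%SET = C j.
  by apply/setP => x; rewrite inE; case: (boolP (x \in C j)) => //= /all_l ->;
    rewrite eqxx.
by rewrite C4.
Qed.

End Colourings.

(** * The relaxation gap *)

Theorem mainTheorem7 (R : realType) (k : nat) (hk : (3 <= k)%N)
    (X : finType) (m : nat) (hm : (1 <= m)%N) (C : 'I_m -> {set X})
    (hC : monotone_nae4sat C) (hlin : linear_instance C)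
    (hocc : forall x : X, exists j : 'I_m, x \in C j) :
  exists SDP MC mu : R,
    [/\ is_SDP k (@graph_weight R X m k C) SDP,
        is_MC k (@graph_weight R X m k C) MC &
        is_min [set y | exists s : vertex X m k -> 'I_k,
                 y = load_defect R C s] mu] /\
    [/\ SDP = 9 / 2 * k%:R * (k%:R - 1) * m%:R,
        SDP - MC = 1 / 2 * mu &
        MC = SDP <-> nae_satisfiable C].
Proof.
have [_ C4] := hC; have k2 : (2 <= k)%N := ltnW hk.
have k1 : 1 < k%:R :> R by rewrite ltr1n.
pose top : R := 9 / 2 * k%:R * (k%:R - 1) * m%:R.
have cutE (P : {set {set vertex X m k}}) (s : vertex X m k -> 'I_k) :
    (forall u v, (finset.pblock P u == finset.pblock P v) = (s u == s v)) ->
    cut_weight (graph_weight R C) P = top - 1 / 2 * load_defect R C s.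
  move=> Ps; rewrite -colouring_cut //.
  by apply: eq_bigr => u _; apply: eq_bigr => v _; rewrite Ps.
have objE (A : vertex X m k -> vertex X m k -> R) : FJ_feasible k A ->
    FJ_objective k (graph_weight R C) A = top - (k%:R - 1) / k%:R / 2 *
      \sum_j quad_form A (fun v => (bvec C j v)%:~R).
  move=> [[Asym _] A1 _]; rewrite /FJ_objective weighted_pair_sum // sumrB.
  rewrite sumr_const card_ord -[_ *+ m]mulr_natl /top; field.
  by lra.
have k_gt0 : (0 < k)%N by apply: ltnW.
pose s0 : {ffun vertex X m k -> 'I_k} := [ffun=> Ordinal k_gt0].
have [smin _ sminP] := @arg_minP _ R _ s0 xpredT
  (fun s => load_defect R C s) isT.
pose mu := load_defect R C smin.
have mu_le (s : vertex X m k -> 'I_k) : mu <= load_defect R C s.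
  have -> : s = (finfun s : {ffun _ -> _}).
    by apply: boolp.funext => v; rewrite ffunE.
  exact: sminP.
exists top, (top - 1 / 2 * mu), mu; split; split=> //.
- split.
  + exists (witness R C); split; first exact: witness_feasible.
    rewrite objE; last exact: witness_feasible.
    by rewrite big1 => [|j _]; rewrite ?mulr0 ?subr0 // witness_balanced.
  + move=> _ [A [feas ->]]; rewrite objE // gerBl; apply: mulr_ge0.
      by rewrite !divr_ge0 //; lra.
    by have [[_ pos] _ _] := feas; apply: sumr_ge0 => j _; apply: pos.
- split.
  + have [P [Ppart Pk Ps]] := colouring_partition smin.
    by exists P; split=> //; rewrite (cutE _ _ Ps).
  + move=> _ [P [Ppart Pk ->]].
    have [s Ps] := partition_colouring Ppart Pk.
    by rewrite (cutE _ _ Ps); have := mu_le s; lra.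
- split; first by exists smin.
  by move=> _ [s ->].
- by lra.
- split=> [e|/(balanced_of_satisfiable k2 C4)[s bal]].
  + have /load_defect_eq0 bal : load_defect R C smin = 0 by rewrite -/mu; lra.
    exact: (satisfiable_of_balanced k2 C4 hm bal).
  + have := mu_le s; have /load_defect_eq0 -> := bal.
    by have := load_defect_ge0 R C smin; rewrite -/mu; lra.
Qed.
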